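(* Let $k$ be a finite field, let $X$ be a nonempty set and let $x\in X$. The map $\pi\colon L(k\langle X\rangle_0)\to L(k[x]_0)$, $U\mapsto \pi(U)$, induces (by restriction) a bijection from $M(k\langle X\rangle_0)$ onto $M(k[x]_0)$, and so every maximal $T$-space of $k\langle X\rangle_0$ is uniquely determined by its one-variable polynomials.
   Context: $k\langle X\rangle_0$ denotes the free (nonunitary) associative $k$-algebra on $X$, and $k[x]_0=xk[x]$ the free (nonunitary) associative $k$-algebra on the single generator $x$, regarded as a subalgebra of $k\langle X\rangle_0$. For an associative $k$-algebra $A$, a $T$-space of $A$ is a $k$-linear subspace of $A$ invariant under every $k$-algebra endomorphism of $A$. $L(A)$ denotes the lattice of all $T$-spaces of $A$ under inclusion, and $M(A)$ denotes the set of maximal $T$-spaces of $A$, i.e. the maximal elements among the proper $T$-spaces of $A$. The $k$-algebra homomorphism $\pi\colon k\langle X\rangle_0\to k[x]_0$ is determined by sending every $z\in X$ to $x$; for a $T$-space $U$ of $k\langle X\rangle_0$, the image $\pi(U)$ is a $T$-space of $k[x]_0$ (and is contained in $U$), so $\pi$ induces a map $L(k\langle X\rangle_0)\to L(k[x]_0)$, also denoted $\pi$. *)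

(* Defs.v *)
From HB Require Import structures.
From mathcomp Require Import all_boot all_order all_algebra.
From mathcomp Require Import boolp classical_sets functions.
From mathcomp.multinomials Require Import monalg.

Set Implicit Arguments.
Unset Strict Implicit.
Unset Printing Implicit Defensive.

Import GRing.Theory.

Local Open Scope classical_set_scope.
Local Open Scope ring_scope.

(* MathComp algebras are unitary, so a nonunitary associative algebra is
   represented as a (nonunitary) subalgebra A of a unitary algebra B; the
   notions below depend only on A and on the operations of B restricted to A. *)
Section Tspaces.
Variables (k : fieldType) (B : algType k).
Implicit Types A U V : set B.

(* The values of f outside A are irrelevant; f need not preserve 1. *)
Definition alg_endo A (f : B -> B) : Prop :=
  [/\ {homo f : a / A a},
      forall (c : k) (a b : B), A a -> A b -> f (c *: a + b) = c *: f a + f b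
    & forall a b : B, A a -> A b -> f (a * b) = f a * f b].

Definition lin_subspace U : Prop :=
  U 0 /\ forall (c : k) (a b : B), U a -> U b -> U (c *: a + b).

Definition Tspace A U : Prop :=
  [/\ U `<=` A, lin_subspace U
    & forall f : B -> B, alg_endo A f -> f @` U `<=` U].

Definition Tlattice A : set (set B) := [set U | Tspace A U].

Definition maxTspaces A : set (set B) :=
  [set U | [/\ Tspace A U, U <> A
             & forall V, Tspace A V -> V <> A -> U `<=` V -> V = U]].

End Tspaces.

(* k<X>, the monoid algebra of the free monoid of words in X. *)
Definition free_alg (k : fieldType) (X : choiceType) : Type :=
  {malg k[{fmonom X}]}.

Section FreeAlgebra.
Variables (k : fieldType) (X : choiceType).

HB.instance Definition _ :=
  GRing.Lalgebra.copy (free_alg k X) {malg k[{fmonom X}]}.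

Fact free_alg_scalerAr (c : k) (p q : free_alg k X) :
  c *: (p * q) = p * (c *: q).
Proof.
apply/malgP => m; rewrite mcoeffZ.
rewrite (mcoeffMlw (d1 := msupp p) (d2 := msupp q)) //.
rewrite (mcoeffMlw (d1 := msupp p) (d2 := msupp q)) ?msuppZ_le //.
rewrite mulr_sumr; apply: eq_bigr => m1 _.
rewrite mulr_sumr; apply: eq_bigr => m2 _.
by rewrite mcoeffZ mulrnAr mulrCA.
Qed.

HB.instance Definition _ :=
  GRing.Lalgebra_isAlgebra.Build k (free_alg k X) free_alg_scalerAr.

Definition gen (z : X) : free_alg k X := << fmu z >>.

(* k<X>_0: no constant term. *)
Definition free_alg0 : set (free_alg k X) := [set p : free_alg k X | p@_(mone : {fmonom X}) = 0].

Variable x : X.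

(* x k[x], inside k<X>. *)
Definition poly_alg0 : set (free_alg k X) :=
  [set gen x * horner_alg (gen x) p | p in [set: {poly k}]].

(* The unitary extension to k<X> of the homomorphism sending every z to x. *)
Definition proj_x : free_alg k X -> free_alg k X :=
  mmap (in_alg (free_alg k X)) (fun m : {fmonom X} => \prod_(z <- m) gen x).

Definition proj_x_space (U : set (free_alg k X)) : set (free_alg k X) :=
  proj_x @` U.

End FreeAlgebra.

(* Main.v *)
Require Import Defs.
From HB Require Import structures.
From mathcomp Require Import all_boot all_order all_algebra.
From mathcomp Require Import boolp classical_sets functions.
From mathcomp.multinomials Require Import monalg.

(** The algebra x k[x] is a retract of k<X>_0 through the projection pi, and the
single element x generates either algebra as a T-space, because any element is
the image of x under an endomorphism.  Everything follows from these two facts.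

A T-space is proper exactly when it misses x, so proper T-spaces are stable
under unions of chains, and by Zorn's lemma each of them lies in a maximal one
([sub_maxTspace]).  As pi is an endomorphism of k<X>_0, the image pi(U) is the
trace of U on x k[x] ([image_retract]).

In the other direction, a T-space V of x k[x] has a lift ([Tlift]): the f in
k<X>_0 all of whose values under homomorphisms k<X>_0 -> x k[x] lie in V.
The lift is a T-space, its image under pi is V, and it contains every T-space U
with pi(U) contained in V; so pi and the lift form a Galois connection.
Consequently the lift of a maximal T-space is maximal.  Conversely, if U is
maximal, enlarge the proper T-space pi(U) to a maximal V; then U is contained in
the proper T-space lifted from V, so it equals this lift, and pi(U) = V.  Thus
the lift inverts pi on maximal T-spaces.

The endomorphisms that the argument uses are the substitutions of one element u
for all variables ([subst_all]): u = x gives pi, and an arbitrary u without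
constant term shows that x generates. *)

Set Implicit Arguments.
Unset Strict Implicit.
Unset Printing Implicit Defensive.

Import GRing.Theory.

Local Open Scope classical_set_scope.
Local Open Scope ring_scope.

(** * Endomorphisms and T-spaces of a subalgebra *)

Section TspaceTheory.
Variables (k : fieldType) (B : algType k).
Implicit Types (A U V W : set B) (f g : B -> B).

Lemma alg_endo0 A f : A 0 -> alg_endo A f -> f 0 = 0.
Proof.
move=> A0 [_ flin _]; have := flin 1 0 0 A0 A0.
by rewrite !scale1r addr0 => /eqP; rewrite -subr_eq0 opprD addNKr oppr_eq0
  => /eqP.
Qed.

(** The codomain of [f] is [A] and the domain of [g] is only [P], which lets
endomorphisms of a retract be transported to the whole algebra. *)
Lemma alg_endo_comp A P f g : alg_endo A f -> set_fun A P f ->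
  alg_endo P g -> P `<=` A -> alg_endo A (g \o f).
Proof.
move=> [_ flin fM] fP [gP glin gM] PA; split=> [a Aa|c a b Aa Ab|a b Aa Ab] /=.
- exact/PA/gP/fP.
- by rewrite flin // glin //; exact: fP.
- by rewrite fM // gM //; exact: fP.
Qed.

Lemma alg_endo_sub A P f : P `<=` A -> alg_endo A f -> set_fun A P f ->
  alg_endo P f.
Proof.
move=> PA [_ flin fM] fP; split=> [a Pa|c a b Pa Pb|a b Pa Pb].
- exact/fP/PA.
- by apply: flin; exact: PA.
- by apply: fM; exact: PA.
Qed.

Definition Tgenerator A (x : B) : Prop :=
  A x /\ forall u, A u -> exists2 f, alg_endo A f & f x = u.

Lemma Tspace_eq_generator A x U : Tgenerator A x -> Tspace A U ->
  U x -> U = A.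
Proof.
move=> [_ xgen] [UA _ Uendo] Ux; apply/seteqP; split=> // u Au.
by have [f fA <-] := xgen u Au; apply: (Uendo f) => //; exists x.
Qed.

Lemma Tspace_bigcup_chain (I : Type) (D : set I) (F : I -> set B) A :
  D !=set0 -> (forall i, D i -> Tspace A (F i)) ->
  (forall i j, D i -> D j -> F i `<=` F j \/ F j `<=` F i) ->
  Tspace A (\bigcup_(i in D) F i).
Proof.
move=> [i0 Di0] FT Fchain; split=> [a [i /FT[FA _ _]] /FA //||].
- split=> [|c a b [i Di Fa] [j Dj Fb]].
    by exists i0 => //; have [_ [] ] := FT _ Di0.
  have [Fij|Fji] := Fchain _ _ Di Dj.
    exists j => //; have [_ [_ lin] _] := FT _ Dj.
    by apply: lin => //; exact: Fij.
  exists i => //; have [_ [_ lin] _] := FT _ Di.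
  by apply: lin => //; exact: Fji.
- move=> f fA _ [a [i Di Fa] <-]; exists i => //.
  by have [_ _ Fendo] := FT _ Di; apply: Fendo fA _ _; exists a.
Qed.

(** A proper T-space is one that misses [x], and this survives unions of
chains. *)
Lemma sub_maxTspace A x V : Tgenerator A x -> Tspace A V -> V <> A ->
  exists2 W, maxTspaces A W & V `<=` W.
Proof.
move=> xgen VT VA.
(* Zorn is applied to the sets by which V is enlarged, as the union of the
   empty chain must be admissible too. *)
pose P := [set W | Tspace A (V `|` W) /\ ~ (V `|` W) x].
have P0 : P set0.
  by split; rewrite setU0 // => /(Tspace_eq_generator xgen VT).
have [F FP Ftot|W [[WT Wx] Wmax]] := @Zorn_bigcup _ P.
- have PF W : ([set set0] `|` F) W -> P W by move=> [->//|/FP].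
  have VF : V `|` \bigcup_(W in F) W =
      \bigcup_(W in [set set0] `|` F) (V `|` W).
    apply/seteqP; split=> [a [Va|[W FW Wa]]|a [W FW [Va|Wa]]].
    + by exists set0; left.
    + by exists W; right.
    + by left.
    + by case: FW Wa => [->//|FW Wa]; right; exists W.
  split; rewrite VF; last by move=> [W /PF[_ Wx]].
  apply: Tspace_bigcup_chain => [|W /PF[]//|W1 W2 FW1 FW2].
    by exists set0; left.
  suff [W12|W21] : W1 `<=` W2 \/ W2 `<=` W1.
  + by left; exact: setUS.
  + by right; exact: setUS.
  case: FW1 FW2 => [->|FW1] [->|FW2]; [by left|by left|by right|].
  exact: Ftot.
exists (V `|` W) => //; split=> // [VWA|V' V'T V'A sV'].
  by apply: Wx; rewrite VWA; case: xgen.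
apply/seteqP; split=> // a V'a; right.
apply: contrapT => Wa; apply: (Wmax V').
  by split=> [b Wb|V'W]; [apply: sV'; right|exact/Wa/V'W].
have VV' : V `|` V' = V' by apply/setUidPr => b Vb; apply: sV'; left.
by split; rewrite VV' // => /(Tspace_eq_generator xgen V'T).
Qed.

End TspaceTheory.

(** * Maximal T-spaces of a retract *)

Section Retract.
Variables (k : fieldType) (B : algType k) (A P : set B) (pi : B -> B) (x : B).
Hypotheses (A_lin : lin_subspace A) (PA : P `<=` A).
Hypotheses (pi_endo : alg_endo A pi) (piP : set_fun A P pi).
Hypothesis pi_id : {in P, pi =1 id}.
Hypotheses (Px : P x) (x_gen : Tgenerator A x).
Implicit Types U V W : set B.

Let pi_idP a : P a -> pi a = a. Proof. by move=> Pa; rewrite pi_id ?inE. Qed.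

Lemma retract_Tgenerator : Tgenerator P x.
Proof.
split=> // u Pu; have [f fA fx] := x_gen.2 u (PA Pu).
exists (pi \o f); last by rewrite /= fx pi_idP.
have [fAA _ _] := fA.
apply: (alg_endo_sub PA) => [|a Aa /=]; last exact/piP/fAA.
exact: alg_endo_comp fA fAA pi_endo (@subset_refl _ A).
Qed.

(** The equality turns statements about images under [pi] into statements about
intersections, which inherit linearity from [U] and [P]. *)
Lemma image_retract U : Tspace A U -> pi @` U = U `&` P.
Proof.
move=> [UA _ Uendo]; apply/seteqP; split=> [_ [a Ua <-]|a [Ua Pa]].
  by split; [apply: (Uendo pi) => //; exists a|exact/piP/UA].
by exists a => //; exact: pi_idP.
Qed.

(** An endomorphism [g] of [P] extends to the endomorphism [g \o pi] of [A]. *)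
Lemma Tspace_image_retract U : Tspace A U -> Tspace P (pi @` U).
Proof.
move=> UT; rewrite image_retract //; case: (UT) => UA [U0 Ulin] Uendo.
have P0 : P 0 by rewrite -(alg_endo0 A_lin.1 pi_endo); exact: piP A_lin.1.
split=> [a []//||g gP _ [a [Ua Pa] <-]].
- split=> // c a b [Ua Pa] [Ub Pb]; split; first exact: Ulin.
  have [_ pilin _] := pi_endo.
  rewrite -(pi_idP Pa) -(pi_idP Pb) -pilin; [|exact: PA..].
  by apply: piP; apply: A_lin.2; exact: PA.
- split; last by case: gP => gPP _ _; exact: gPP.
  rewrite -(pi_idP Pa); apply: (Uendo (g \o pi)); last by exists a.
  exact: alg_endo_comp pi_endo piP gP PA.
Qed.

(** Quantifying over all homomorphisms to [P], and not only over [pi], makes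
the lift stable under endomorphisms of [A].  The preimage of V under pi is not
stable in general: in the free algebra it contains z - x for every variable z,
and the substitution of 0 for z alone maps z - x to -x. *)
Definition Tlift V : set B :=
  [set a | A a /\ forall h, alg_endo A h -> set_fun A P h -> V (h a)].

Lemma Tspace_Tlift V : Tspace P V -> Tspace A (Tlift V).
Proof.
move=> [VP [V0 Vlin] Vendo]; split=> [a []//||f fA _ [a [Aa Va] <-]].
- split=> [|c a b [Aa Va] [Ab Vb]].
    by split=> [|h hA hP]; [exact: A_lin.1|rewrite (alg_endo0 A_lin.1 hA)].
  split=> [|h hA hP]; first exact: A_lin.2.
  by have [_ -> // _] := hA; apply: Vlin; [exact: Va|exact: Vb].
- have [fAA _ _] := fA; split=> [|h hA hP]; first exact: fAA.
  apply: (Va (h \o f)) => [|b Ab /=]; last exact/hP/fAA.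
  exact: alg_endo_comp fA fAA hA (@subset_refl _ A).
Qed.

Lemma sub_Tlift U V : Tspace A U -> pi @` U `<=` V -> U `<=` Tlift V.
Proof.
move=> UT; have [UA _ Uendo] := UT; rewrite image_retract // => UV a Ua.
split=> [|h hA hP]; first exact: UA.
by apply: UV; split; [apply: (Uendo h) => //; exists a|exact/hP/UA].
Qed.

Lemma image_Tlift V : Tspace P V -> pi @` Tlift V = V.
Proof.
move=> VT; have [VP _ Vendo] := VT.
apply/seteqP; split=> [_ [a [Aa Va] <-]|a Va]; first exact: Va.
exists a; last exact/pi_idP/VP.
split=> [|h hA hP]; first exact/PA/VP.
by apply: (Vendo h); [exact: alg_endo_sub hA hP|exists a].
Qed.

Lemma Tlift_proper V : Tspace P V -> V <> P -> Tlift V <> A.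
Proof.
move=> VT VnP LA; apply: VnP.
by rewrite -(image_Tlift VT) LA image_retract ?setIidr //;
  split=> // f [fA _ _] _ [a Aa <-]; exact: fA.
Qed.

Lemma image_proper U : Tspace A U -> U <> A -> pi @` U <> P.
Proof.
move=> UT UA piUP; apply: UA; apply: (Tspace_eq_generator x_gen) => //.
by move: Px; rewrite -piUP image_retract // => -[].
Qed.

(** A proper T-space above the lift of [V] has a proper image containing [V],
hence equal to [V] by maximality; so it lies in the lift. *)
Lemma maxTspaces_Tlift V : maxTspaces P V -> maxTspaces A (Tlift V).
Proof.
move=> [VT VnP Vmax]; split; [exact: Tspace_Tlift|exact: Tlift_proper|].
move=> W WT WnA sLW; apply/seteqP; split=> //; apply: sub_Tlift => //.
suff -> : pi @` W = V by [].
apply: Vmax; [exact: Tspace_image_retract|exact: image_proper|].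
by rewrite -[X in X `<=` _]image_Tlift //; exact: image_subset.
Qed.

(** A maximal [V] above [pi @` U] has a proper lift containing [U], so the lift
is [U] itself. *)
Lemma maxTspace_lifted U : maxTspaces A U ->
  exists2 V, maxTspaces P V & U = Tlift V.
Proof.
move=> [UT UnA Umax].
have [V Vmax sUV] := sub_maxTspace retract_Tgenerator
  (Tspace_image_retract UT) (image_proper UT UnA).
have [VT VnP _] := Vmax; exists V => //; apply/esym/Umax.
- exact: Tspace_Tlift.
- exact: Tlift_proper.
- exact: sub_Tlift.
Qed.

Lemma maxTspaces_retract_bij :
  set_bij (maxTspaces A) (maxTspaces P) (fun U => pi @` U).
Proof.
split=> [U /maxTspace_lifted[V Vmax ->]|U1 U2|V Vmax].
- by rewrite image_Tlift //; case: Vmax.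
- rewrite !inE => /maxTspace_lifted[V1 [V1T _ _] ->].
  move=> /maxTspace_lifted[V2 [V2T _ _] ->].
  by rewrite !image_Tlift // => ->.
- exists (Tlift V); first exact: maxTspaces_Tlift.
  by apply: image_Tlift; case: Vmax.
Qed.

End Retract.

(** * Substitution of one element for all variables *)

Section Substitution.
Variables (k : fieldType) (X : choiceType).
Local Notation F := (free_alg k X).
Local Notation A := (@free_alg0 k X).
Local Notation P := (@poly_alg0 k X).
Implicit Types (u : F) (x : X).

Definition word_pow u (m : {fmonom X}) : F := \prod_(z <- m) u.

Lemma word_pow_mmorphism u : mmorphism (word_pow u).
Proof. by split=> [m1 m2|]; rewrite /word_pow ?fmM ?big_cat // fm1 big_nil. Qed.

HB.instance Definition _ u :=
  isMultiplicative.Build {fmonom X} F (word_pow u) (word_pow_mmorphism u).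

Definition subst_all u : F -> F := mmap (in_alg F) (word_pow u).

Lemma subst_all_gen u x : subst_all u (gen k x) = u.
Proof. by rewrite /subst_all mmapU /= /word_pow fmU big_seq1 scale1r mul1r. Qed.

Lemma subst_all_additive u : additive (subst_all u).
Proof. exact: mmap_is_additive. Qed.

Lemma subst_all_multiplicative u : multiplicative (subst_all u).
Proof.
apply: commr_mmap_is_multiplicative => g m m'.
by rewrite /GRing.comm /= mulr_algl mulr_algr.
Qed.

Lemma subst_all_scalable u : scalable (subst_all u).
Proof. by move=> c g; rewrite /subst_all mmapZ /= mulr_algl. Qed.

HB.instance Definition _ u :=
  GRing.isAdditive.Build F F (subst_all u) (subst_all_additive u).
HB.instance Definition _ u :=
  GRing.isMultiplicative.Build F F (subst_all u) (subst_all_multiplicative u).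
HB.instance Definition _ u :=
  GRing.isScalable.Build k F F *:%R (subst_all u) (subst_all_scalable u).

Definition mul_closed (S : set F) := forall a b, S a -> S b -> S (a * b).

(** Every word of [a] is nonempty, so its value is a positive power of [u]. *)
Lemma subst_all_in (S : set F) u a : lin_subspace S -> mul_closed S -> S u ->
  A a -> S (subst_all u a).
Proof.
move=> [S0 Slin] SM Su a0; rewrite /subst_all /mmap big_seq.
apply: (big_ind S) => // [v w Sv Sw|m m_a].
  by rewrite -[v]scale1r; exact: Slin.
rewrite /= mulr_algl -[_ *: _]addr0; apply: Slin => //.
have : m != mone :> {fmonom X}.
  by apply: contraTneq m_a => ->; rewrite -mcoeff_eq0; apply/eqP.
rewrite /word_pow fmP fm1; case: (m : seq X) => // z s _.
elim: s z => [|y s IH] z; first by rewrite big_seq1.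
by rewrite big_cons; exact: SM.
Qed.

Lemma free_alg0_lin : lin_subspace A.
Proof.
split=> [|c a b Aa Ab]; first exact: mcoeff0.
by rewrite /free_alg0 /= mcoeffD mcoeffZ Aa Ab mulr0 addr0.
Qed.

Lemma free_alg0_mul a b : A a -> A (a * b).
Proof. by move=> Aa; rewrite /free_alg0 /= rmorphM /= Aa mul0r. Qed.

Lemma gen_free_alg0 x : A (gen k x).
Proof. by rewrite /free_alg0 /= mcoeffU1 fm1_eq1. Qed.

Lemma poly_alg0_sub x : P x `<=` A.
Proof. by move=> _ [p _ <-]; exact/free_alg0_mul/gen_free_alg0. Qed.

Lemma poly_alg0_lin x : lin_subspace (P x).
Proof.
split=> [|c _ _ [p _ <-] [q _ <-]]; first by exists 0; rewrite // rmorph0 mulr0.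
exists (c *: p + q) => //.
by rewrite rmorphD -mul_polyC rmorphM /= horner_algC mulr_algl mulrDr scalerAr.
Qed.

Lemma poly_alg0_mul x : mul_closed (P x).
Proof.
move=> _ _ [p _ <-] [q _ <-]; exists (p * ('X * q)); first exact: I.
by rewrite !rmorphM /= horner_algX -!mulrA.
Qed.

Lemma gen_poly_alg0 x : P x (gen k x).
Proof. by exists 1; rewrite // rmorph1 mulr1. Qed.

Lemma subst_all_endo u : A u -> alg_endo A (subst_all u).
Proof.
move=> Au; split=> [a Aa|c a b _ _|a b _ _]; last 2 first.
- by rewrite linearP.
- by rewrite rmorphM.
by apply: subst_all_in => //; [exact: free_alg0_lin|move=> ? ? /free_alg0_mul].
Qed.

Lemma free_alg0_generator x : Tgenerator A (gen k x).
Proof.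
split=> [|u Au]; first exact: gen_free_alg0.
by exists (subst_all u); [exact: subst_all_endo|exact: subst_all_gen].
Qed.

Lemma proj_x_poly x : {in P x, proj_x x =1 id}.
Proof.
move=> _ /set_mem[p _ <-]; rewrite -[proj_x x]/(subst_all (gen k x)).
rewrite rmorphM /= subst_all_gen; congr (_ * _).
elim/poly_ind: p => [|p c IHp]; first by rewrite !rmorph0.
rewrite (rmorphD (horner_alg _)) (rmorphM (horner_alg _)) /=.
rewrite horner_algX horner_algC (rmorphD (subst_all _)) (rmorphM (subst_all _)).
by rewrite /= IHp subst_all_gen linearZ /= rmorph1.
Qed.

Lemma proj_x_endo x : alg_endo A (proj_x x).
Proof. exact/subst_all_endo/gen_free_alg0. Qed.

Lemma proj_x_to_poly x : set_fun A (P x) (proj_x x).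
Proof.
move=> a Aa; apply: subst_all_in => //; [exact: poly_alg0_lin| |].
  exact: poly_alg0_mul.
exact: gen_poly_alg0.
Qed.

End Substitution.

Theorem proposition2p3 (k : finFieldType) (X : choiceType) (x : X) :
  [/\ set_fun (Tlattice (@free_alg0 k X)) (Tlattice (@poly_alg0 k X x))
        (@proj_x_space k X x),
      set_bij (maxTspaces (@free_alg0 k X)) (maxTspaces (@poly_alg0 k X x))
        (@proj_x_space k X x)
    & forall U V : set (free_alg k X),
        maxTspaces (@free_alg0 k X) U -> maxTspaces (@free_alg0 k X) V ->
        U `&` @poly_alg0 k X x = V `&` @poly_alg0 k X x -> U = V].
Proof.
have A_lin := @free_alg0_lin k X.
have PA := @poly_alg0_sub k X x.
have pi_endo := @proj_x_endo k X x.
have piP := @proj_x_to_poly k X x.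
have pi_id := @proj_x_poly k X x.
have bij := maxTspaces_retract_bij A_lin PA pi_endo piP pi_id
  (gen_poly_alg0 _ x) (free_alg0_generator _ x).
split=> // [U|U V Umax Vmax UV]; first exact: Tspace_image_retract.
have [_ inj _] := bij; apply: inj; rewrite ?inE //.
have [[UT _ _] [VT _ _]] := (Umax, Vmax).
by rewrite !(image_retract pi_endo piP pi_id).
Qed.
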